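(* Let $(H,\langle\cdot,\cdot\rangle_H)$ be a separable real Hilbert space, let $(\mathcal{F}_t)_{t\ge 0}$ be a filtration, let $(f_t)_{t\ge1}$ be an $H$-valued sequence that is $(\mathcal{F}_t)$-predictable (i.e. $f_t$ is $\mathcal{F}_{t-1}$-measurable) with $\|f_t\|_H<\infty$ for all $t$, and let $(\epsilon_t)_{t\ge1}$ be a real-valued $(\mathcal{F}_t)$-adapted sequence such that, conditionally on $\mathcal{F}_{t-1}$, $\epsilon_t$ is $\sigma$-subGaussian. Define $S_t:=\sum_{s=1}^t\epsilon_s f_s$ and $V_t:=\sum_{s=1}^t f_sf_s^\top$ (with $S_0=0$, $V_0=0$). Then for every $\rho>0$ the process \[ M_t:=\frac{1}{\sqrt{\det(\mathrm{id}_H+\rho^{-1}V_t)}}\exp\left\{\frac12\left\|(\rho\,\mathrm{id}_H+V_t)^{-1/2}S_t/\sigma\right\|_H^2\right\} \] is a non-negative supermartingale with respect to $(\mathcal{F}_t)_{t\ge0}$. Consequently, for every $\delta\in(0,1)$, with probability at least $1-\delta$, simultaneously for all $t\ge 1$, \[ \left\|(V_t+\rho\,\mathrm{id}_H)^{-1/2}S_t\right\|_H\le\sigma\sqrt{2\log\left(\frac1\delta\sqrt{\det(\mathrm{id}_H+\rho^{-1}V_t)}\right)}. \]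
   Context: For $f,g\in H$, $fg^\top$ denotes the rank-one operator $h\mapsto f\langle g,h\rangle_H$; $\mathrm{id}_H$ is the identity on $H$. A real random variable $\epsilon$ is $\sigma$-subGaussian conditioned on a $\sigma$-algebra $\mathcal{F}$ if $\log\mathbb{E}(e^{\lambda\epsilon}\mid\mathcal{F})\le\lambda^2\sigma^2/2$ for all $\lambda\in\mathbb{R}$. For a self-adjoint finite-rank operator $A$ on $H$ with nonzero eigenvalues $\lambda_1(A),\dots,\lambda_k(A)$, the Fredholm determinant is $\det(\mathrm{id}_H+A):=\prod_{i=1}^k(1+\lambda_i(A))$. *)

(* Defs.v *)
From HB Require Import structures.
From mathcomp Require Import all_boot all_order all_algebra.
From mathcomp Require Import all_classical all_reals all_analysis.
Set Implicit Arguments. Unset Strict Implicit. Unset Printing Implicit Defensive.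
Import Order.TTheory GRing.Theory Num.Theory.
Import numFieldNormedType.Exports.
Local Open Scope classical_set_scope.
Local Open Scope ring_scope.

Definition is_inner_product {R : realType} {H : normedModType R}
  (ip : H -> H -> R) : Prop :=
  [/\ (forall x y, ip x y = ip y x),
      (forall a x y z, ip (a *: x + y) z = a * ip x z + ip y z),
      (forall x, 0 <= ip x x),
      (forall x, ip x x = 0 -> x = 0) &
      (forall x, `|x| = Num.sqrt (ip x x))].

Definition separable_hilbert {R : realType} {H : completeNormedModType R}
  (ip : H -> H -> R) : Prop :=
  is_inner_product ip /\ exists D : set H, countable D /\ closure D = setT.

Section Spectral.
Context {R : realType} {H : normedModType R} (ip : H -> H -> R).

Definition orthonormal (e : seq H) : Prop :=
  forall i j, (i < size e)%N -> (j < size e)%N ->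
    ip (nth 0 e i) (nth 0 e j) = (i == j)%:R.

Definition spec_decomp (A : H -> H) (e : seq H) (l : seq R) : Prop :=
  [/\ size e = size l, orthonormal e, all (fun x => x != 0) l &
      forall h, A h = \sum_(i < size e) (nth 0 l i * ip (nth 0 e i) h) *: nth 0 e i].

(* a chosen spectral decomposition (exists for finite-rank self-adjoint A) *)
Definition sdec (A : H -> H) : seq H * seq R :=
  xget ([::], [::]) [set p | spec_decomp A p.1 p.2].

(* Fredholm determinant det(id_H + A) = prod_i (1 + lambda_i(A)) *)
Definition fdet (A : H -> H) : R := \prod_(x <- (sdec A).2) (1 + x).

(* functional calculus: g(A) for finite-rank self-adjoint A, i.e. g(0) on
   the kernel of A and g(lambda_i) on the eigenvector e_i *)
Definition opfun (g : R -> R) (A : H -> H) (h : H) : H :=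
  let e := (sdec A).1 in let l := (sdec A).2 in
  g 0 *: (h - \sum_(i < size e) ip (nth 0 e i) h *: nth 0 e i)
  + \sum_(i < size e) (g (nth 0 l i) * ip (nth 0 e i) h) *: nth 0 e i.

Definition rank_one (f g : H) : H -> H := fun h => ip g h *: f.

Definition shift_inv_sqrt (rho : R) (A : H -> H) : H -> H :=
  opfun (fun x => (Num.sqrt (rho + x))^-1) A.

End Spectral.

Section Prob.
Context {d : measure_display} {T : measurableType d} {R : realType}
  (P : probability T R).

Definition filtration (F : nat -> set_system T) : Prop :=
  (forall t, sigma_algebra setT (F t)) /\
  (forall t, F t `<=` measurable) /\
  (forall t, F t `<=` F t.+1).

Definition rmeas (G : set_system T) (X : T -> R) : Prop :=
  forall B : set R, measurable B -> G (X @^-1` B).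

Definition hmeas {H : normedModType R} (G : set_system T) (X : T -> H) : Prop :=
  forall U : set H, open U -> G (X @^-1` U).

(* E[X | G] <= Y a.s., for X >= 0 and Y G-measurable, expressed through the
   defining property of conditional expectation:
   for all A in G, E[X 1_A] <= E[Y 1_A]. *)
Definition cond_exp_le (G : set_system T) (X Y : T -> R) : Prop :=
  rmeas G Y /\
  forall A, G A -> (\int[P]_(x in A) (X x)%:E <= \int[P]_(x in A) (Y x)%:E)%E.

Definition cond_subgaussian (G : set_system T) (sigma : R) (eps : T -> R) : Prop :=
  forall lambda : R,
    cond_exp_le G (fun x => expR (lambda * eps x))
                  (fun _ => expR (lambda ^+ 2 * sigma ^+ 2 / 2)).

Definition supermartingale (F : nat -> set_system T) (M : nat -> T -> R) : Prop :=
  (forall t, rmeas (F t) (M t)) /\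
  (forall t, P.-integrable setT (fun x => (M t x)%:E)) /\
  (forall t, cond_exp_le (F t) (M t.+1) (M t)).

End Prob.

(* Main.v *)
(* With [W = rho id + V_t], passing from [t] to [t.+1] multiplies [M_t] by
     (1 + a)^(-1/2) exp((2 e b + e^2 a - b^2) / (2 (1 + a))),
   where [f] and [e] are the next vector and the next noise divided by [sigma],
   [a = <f, W^-1 f>] and [b = <f, W^-1 (S_t / sigma)>]: Sherman-Morrison handles the
   quadratic form and the matrix determinant lemma handles the determinant.  This
   factor is the average of exp(l e - l^2 / 2) over l ~ N(b, a).  Since [a] and [b]
   are F_t-measurable and [e] is conditionally 1-subGaussian, each of these
   exponentials has conditional expectation at most 1, and by Tonelli so does their
   average.  The uniform bound is Ville's inequality for [M_t], as [M_0 = 1]. *)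
Require Import Defs.
From HB Require Import structures.
From mathcomp Require Import all_boot all_order all_algebra.
From mathcomp Require Import spectral sesquilinear complex.
From mathcomp Require Import all_classical all_reals all_analysis.
From mathcomp Require Import measurable_realfun.
From mathcomp Require Import ring lra.
Set Implicit Arguments. Unset Strict Implicit. Unset Printing Implicit Defensive.
Import Order.TTheory GRing.Theory Num.Theory.
Import numFieldNormedType.Exports.
Local Open Scope classical_set_scope.
Local Open Scope ring_scope.

(** * Finite-rank covariance operators *)

(** Over [R[i]] the matrix is Hermitian, hence diagonalizable with a real diagonal, which is nonzero
    because [A] is. The eigenvalue descends to [R] as a root of a characteristic polynomial with
    coefficients in [R]. *)
Lemma sym_nonzero_eigenvalue (R : rcfType) (n : nat) (A : 'M[R]_n) :
  A^T = A -> A != 0 ->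
  exists a : R, exists v : 'rV_n, [/\ a != 0, v != 0 & v *m A = a *: v].
Proof.
move=> symA nzA.
pose f : {rmorphism R -> R[i]} := real_complex R.
pose AC := map_mx f A.
have hAC : AC \is hermsymmx.
  apply: realsym_hermsym.
    apply/is_hermitianmxP => /=; rewrite expr0 scale1r map_mx_id //.
    by apply/matrixP => i j; rewrite !mxE -{1}symA mxE.
  by apply/mxOverP => i j; rewrite mxE; apply/complex_realP; exists (A i j).
have [k nzk] : exists k, spectral_diag AC 0 k != 0.
  apply/existsP; apply: contraNT nzA => /existsPn d0.
  rewrite -(map_mx_eq0 f) -/AC.
  have /hermitian_normalmx/orthomx_spectralP -> := hAC.
  suff -> : spectral_diag AC = 0 by rewrite linear0 mulmx0 mul0mx.
  by apply/rowP => i; rewrite [RHS]mxE; apply/eqP; have := d0 i; rewrite negbK.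
have /mxOverP/(_ 0 k)/complex_realP[a ak] := hermitian_spectral_diag_real hAC.
have : eigenvalue AC (f a).
  apply/eigenvalueP; exists (row k (spectralmx AC)); last first.
    apply/eqP => r0; have := mulmxV (spectral_unit AC) => /(congr1 (row k)).
    by rewrite row_mul r0 mul0mx => /rowP/(_ k)/eqP; rewrite !mxE eqxx eq_sym oner_eq0.
  have /hermitian_normalmx/orthomx_spectralP eqA := hAC.
  rewrite {2}eqA !mulmxA -row_mul mulmxV ?spectral_unit // row1.
  by rewrite -rowE row_diag_mx -scalemxAl -rowE ak.
rewrite eigenvalue_root_char -map_char_poly fmorph_root -eigenvalue_root_char.
case/eigenvalueP => v vA nzv; exists a, v; split => //.
by apply: contraNneq nzk => a0; rewrite ak a0.
Qed.

(** Sylvester's identity: the block matrix with rows (1, -A) and (B, 1) has two block triangular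
    factorizations. With [n = 1] it is the matrix determinant lemma. *)
Lemma det_1DmulmxC (K : comNzRingType) (m n : nat) (A : 'M[K]_(m, n)) (B : 'M[K]_(n, m)) :
  \det (1%:M + A *m B) = \det (1%:M + B *m A).
Proof.
have EL : block_mx 1%:M (- A) B 1%:M =
    block_mx 1%:M 0 B 1%:M *m block_mx 1%:M (- A) 0 (1%:M + B *m A).
  rewrite mulmx_block !(mul1mx, mul0mx, mulmx1, mulmx0, addr0, mulmxN).
  by rewrite addrCA addNr addr0.
have ER : block_mx 1%:M (- A) B 1%:M =
    block_mx 1%:M (- A) 0 1%:M *m block_mx (1%:M + A *m B) 0 B 1%:M.
  rewrite mulmx_block !(mul1mx, mul0mx, mulmx1, mulmx0, addr0, add0r, mulNmx).
  by rewrite addrK.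
have := congr1 determinant ER; rewrite EL !det_mulmx !det_ublock !det_lblock.
by rewrite !det1 !(mul1r, mulr1).
Qed.

Section InnerProduct.
Context {R : realType} {H : normedModType R} (ip : H -> H -> R).
Context (ipP : is_inner_product ip).

Lemma ipC x y : ip x y = ip y x. Proof. by case: ipP => ->. Qed.

Lemma ipDl x y z : ip (x + y) z = ip x z + ip y z.
Proof. by case: ipP => _ L _ _ _; have := L 1 x y z; rewrite scale1r mul1r. Qed.

Lemma ip0l z : ip 0 z = 0.
Proof. by apply: (addrI (ip 0 z)); rewrite -ipDl !addr0. Qed.

Lemma ipZl a x z : ip (a *: x) z = a * ip x z.
Proof. by case: ipP => _ L _ _ _; have := L a x 0 z; rewrite ip0l !addr0. Qed.

Lemma ipDr x y z : ip z (x + y) = ip z x + ip z y.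
Proof. by rewrite ipC ipDl !(ipC _ z). Qed.

Lemma ipZr a x z : ip z (a *: x) = a * ip z x.
Proof. by rewrite ipC ipZl (ipC _ z). Qed.

Lemma ip0r z : ip z 0 = 0. Proof. by rewrite ipC ip0l. Qed.

Lemma ipNl x z : ip (- x) z = - ip x z.
Proof. by rewrite -scaleN1r ipZl mulN1r. Qed.

Lemma ipNr x z : ip z (- x) = - ip z x.
Proof. by rewrite ipC ipNl ipC. Qed.

Lemma ipBl x y z : ip (x - y) z = ip x z - ip y z.
Proof. by rewrite ipDl ipNl. Qed.

Lemma ipBr x y z : ip z (x - y) = ip z x - ip z y.
Proof. by rewrite ipDr ipNr. Qed.

Lemma ip_suml I (r : seq I) (P : pred I) (F : I -> H) z :
  ip (\sum_(i <- r | P i) F i) z = \sum_(i <- r | P i) ip (F i) z.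
Proof. by apply: (big_morph (ip^~ z)) => [x y|]; [exact: ipDl|exact: ip0l]. Qed.

Lemma ip_sumr I (r : seq I) (P : pred I) (F : I -> H) z :
  ip z (\sum_(i <- r | P i) F i) = \sum_(i <- r | P i) ip z (F i).
Proof. by rewrite ipC ip_suml; apply: eq_bigr => i _; rewrite ipC. Qed.

Lemma ip_ge0 x : 0 <= ip x x. Proof. by case: ipP. Qed.

Lemma ip_eq0 x : ip x x = 0 -> x = 0. Proof. by case: ipP => _ _ _ + _; apply. Qed.

Lemma norm_ip x : `|x| ^+ 2 = ip x x.
Proof. by case: ipP => _ _ _ _ ->; rewrite sqr_sqrtr ?ip_ge0. Qed.

(** V_t at one sample point, indexed from 0: [g s] stands for f_(s+1). *)
Definition covop (t : nat) (g : nat -> H) (h : H) : H :=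
  \sum_(s < t) rank_one ip (g s) (g s) h.

Lemma covop0 g h : covop 0 g h = 0. Proof. by rewrite /covop big_ord0. Qed.

Lemma covopS t g h : covop t.+1 g h = covop t g h + ip (g t) h *: g t.
Proof. by rewrite /covop big_ord_recr. Qed.

Lemma covopD t g x y : covop t g (x + y) = covop t g x + covop t g y.
Proof.
rewrite /covop -big_split /=; apply: eq_bigr => s _.
by rewrite /rank_one ipDr scalerDl.
Qed.

Lemma covopZ t g a x : covop t g (a *: x) = a *: covop t g x.
Proof.
rewrite /covop scaler_sumr; apply: eq_bigr => s _.
by rewrite /rank_one ipZr scalerA.
Qed.

Lemma covopB t g x y : covop t g (x - y) = covop t g x - covop t g y.
Proof. by rewrite -(scaleN1r y) covopD covopZ scaleN1r. Qed.

Lemma ip_covop t g x y : ip (covop t g x) y = \sum_(s < t) ip (g s) x * ip (g s) y.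
Proof. by rewrite ip_suml; apply: eq_bigr => s _; rewrite ipZl. Qed.

Lemma covop_sym t g x y : ip (covop t g x) y = ip x (covop t g y).
Proof.
by rewrite [RHS]ipC !ip_covop; apply: eq_bigr => s _; rewrite mulrC.
Qed.

Lemma covop_ge0 t g x : 0 <= ip (covop t g x) x.
Proof. by rewrite ip_covop sumr_ge0 // => s _; rewrite -expr2 sqr_ge0. Qed.

(** Positive definiteness of [rho id + V]: pair the difference with itself. A preimage under this
    operator can then be identified by checking its equation. *)
Lemma covop_shift_inj (rho : R) t g x y : 0 < rho ->
  rho *: x + covop t g x = rho *: y + covop t g y -> x = y.
Proof.
move=> rho0 /eqP; rewrite -subr_eq0 opprD addrACA -covopB -scalerBr => /eqP xy.
apply/eqP; rewrite -subr_eq0; apply/eqP/ip_eq0/eqP.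
have := congr1 (ip^~ (x - y)) xy; rewrite ipDl ipZl ip0l => /eqP.
have p0 : 0 <= rho * ip (x - y) (x - y) by rewrite mulr_ge0 ?ip_ge0 // ltW.
rewrite paddr_eq0 ?covop_ge0 // => /andP[+ _].
by rewrite mulf_eq0 gt_eqF.
Qed.

Lemma spec_decomp_nth A e l i : spec_decomp ip A e l -> (i < size e)%N ->
  A (nth 0 e i) = nth 0 l i *: nth 0 e i.
Proof.
move=> [_ on _ ->] ie; rewrite (bigD1 (Ordinal ie)) //= on // eqxx mulr1.
rewrite big1 ?addr0 // => j ji; rewrite on //.
by rewrite (_ : (j == i :> nat) = false) ?mulr0 ?scale0r //; apply/negbTE.
Qed.

Lemma spec_decomp_scale c A e l : c != 0 -> spec_decomp ip A e l ->
  spec_decomp ip (fun h => c *: A h) e [seq c * x | x <- l].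
Proof.
move=> c0 [sz on nz Ae]; split => //.
- by rewrite size_map.
- by rewrite all_map; apply: sub_all nz => x x0 /=; rewrite mulf_neq0.
- move=> h; rewrite Ae scaler_sumr; apply: eq_bigr => i _.
  by rewrite scalerA (nth_map 0) -?sz // mulrA.
Qed.

Lemma spec_decomp_cons A e l u a :
  ip u u = 1 -> a != 0 -> A u = 0 -> (forall h, ip u (A h) = 0) ->
  spec_decomp ip A e l ->
  spec_decomp ip (fun h => A h + (a * ip u h) *: u) (u :: e) (a :: l).
Proof.
move=> u1 a0 Au uA D; have [sz on nz Ae] := D.
(* Its eigenvalue being nonzero, [nth 0 e i] lies in the range of [A], to which [u] is
   orthogonal. *)
have ue i : (i < size e)%N -> ip u (nth 0 e i) = 0.
  move=> ie; have := uA (nth 0 e i); rewrite (spec_decomp_nth D ie) ipZr => /eqP.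
  by rewrite mulf_eq0 (negbTE (all_nthP 0 nz _ _)) -?sz //= => /eqP.
split => //=.
- by rewrite sz.
- move=> [|i] [|j] //=; rewrite ?ltnS => ie je.
  + by rewrite ue.
  + by rewrite ipC ue.
  + exact: on.
- by rewrite a0.
- by move=> h; rewrite big_ord_recl /= Ae addrC.
Qed.

Definition gram (t : nat) (g : nat -> H) : 'M[R]_t :=
  \matrix_(i, j) ip (g i) (g j).

(* Deflation: projecting the [g s] on the orthogonal of an eigenvector
   subtracts that eigenvector from [covop] and lowers the rank of the Gram
   matrix. *)
Lemma covop_spec_decomp t g : exists e l, spec_decomp ip (covop t g) e l.
Proof.
have [n] := ubnP (\rank (gram t g)); elim: n g => // n IHn g.
have [G0 _|G0 rk] := eqVneq (gram t g) 0.
  exists [::], [::]; split => // h; rewrite big_ord0 /covop big1 // => s _.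
  rewrite /rank_one (ip_eq0 (x := g s)) ?scaler0 //.
  by have := congr1 (fun M : 'M[R]_t => M s s) G0; rewrite !mxE.
have symG : (gram t g)^T = gram t g by apply/matrixP => i j; rewrite !mxE ipC.
have [a [v [a0 v0 vG]]] := sym_nonzero_eigenvalue symG G0.
(* A Gram eigenvector gives an eigenvector of V: [v G = a v] reads [ip w (g j) = a v_j], whence
   [V w = a w]. *)
pose w := \sum_(s < t) v 0 s *: g s.
have wg (j : 'I_t) : ip w (g j) = a * v 0 j.
  have := congr1 (fun M : 'rV[R]_t => M 0 j) vG; rewrite !mxE => <-.
  by rewrite ip_suml; apply: eq_bigr => s _; rewrite ipZl mxE.
have ww : ip w w = a * \sum_s v 0 s ^+ 2.
  rewrite {2}/w ip_sumr mulr_sumr; apply: eq_bigr => s _.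
  by rewrite ipZr wg expr2 mulrCA.
have vv : 0 < \sum_s v 0 s ^+ 2.
  rewrite lt_def sumr_ge0 ?andbT; last by move=> *; exact: sqr_ge0.
  apply: contraNneq v0 => /psumr_eq0P v0; apply/eqP/rowP => i; rewrite mxE.
  by apply/eqP; rewrite -sqrf_eq0 v0 // => *; exact: sqr_ge0.
have ww0 : 0 < ip w w.
  by rewrite lt_def ip_ge0 andbT ww mulf_neq0 // gt_eqF.
pose k := (Num.sqrt (ip w w))^-1; pose u := k *: w.
have kk : k ^+ 2 * ip w w = 1.
  by rewrite /k exprVn sqr_sqrtr ?ip_ge0 // mulVf // gt_eqF.
have k0 : k != 0 by rewrite invr_eq0 gt_eqF // sqrtr_gt0.
have uu : ip u u = 1 by rewrite ipZl ipZr mulrA -expr2.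
have ug (j : 'I_t) : ip u (g j) = k * a * v 0 j by rewrite ipZl wg mulrA.
have Vu : covop t g u = a *: u.
  rewrite {2}/u /w scalerA scaler_sumr; apply: eq_bigr => s _.
  by rewrite /rank_one ipC ug scalerA (mulrC a).
have uw : ip u w *: u = w by rewrite /u scalerA ipZl mulrAC -expr2 kk scale1r.
clearbody u.
pose g' s := g s - ip u (g s) *: u.
have ug' s : ip u (g' s) = 0 by rewrite ipBr ipZr uu mulr1 subrr.
(* Expanding the projected rank-one terms leaves three corrections equal to [a (ip u h) u] up to
   sign, because [V u = a u]; two are subtracted and one is added. *)
have V'E h : covop t g' h = covop t g h - (a * ip u h) *: u.
  transitivity (\sum_(s < t) (ip (g s) h *: g s - ip u h *: (ip (g s) u *: g s)
     - (ip (g s) h * ip (g s) u - ip u h * (ip (g s) u * ip (g s) u)) *: u)).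
    rewrite /covop; apply: eq_bigr => s _; rewrite /rank_one /g' ipBl ipZl (ipC u (g s)).
    rewrite scalerBr scalerA scalerBl scalerA (mulrC (ip u h)); congr (_ - _ *: _).
    ring.
  rewrite !sumrB -scaler_sumr -scaler_suml sumrB -mulr_sumr -!ip_covop.
  rewrite -[\sum_(i < t) ip (g i) h *: g i]/(covop t g h).
  rewrite -[\sum_(i < t) ip (g i) u *: g i]/(covop t g u) Vu covop_sym Vu.
  by rewrite ipZl ipZr uu (ipC h) scalerA -addrA -opprD -scalerDl; congr (_ - _ *: _); ring.
have lt_rk : (\rank (gram t g') < \rank (gram t g))%N.
  have g'E : gram t g' = (1%:M - k *: ((\row_j ip u (g j))^T *m v)) *m gram t g.
    rewrite mulmxBl mul1mx -scalemxAl -mulmxA vG; apply/matrixP => i j.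
    rewrite !mxE big_ord1 !mxE /g' ipBr ipZr ipBl ipZl (ipBl _ _ u) ipZl uu !ug.
    by rewrite (ipC (g i) u) ug; ring.
  have sub : (gram t g' <= gram t g)%MS by rewrite g'E submxMl.
  (* [v] is in the row space of [gram t g], hence in that of [gram t g'] if the ranks agree; but
     [gram t g'] kills [v^T], which would force [v v^T = 0]. *)
  rewrite ltn_neqAle mxrankS // andbT; apply: contraTneq vv => rkE.
  have /submxP[y yE] : (v <= gram t g')%MS.
    have : (gram t g' == gram t g)%MS by rewrite -mxrank_leqif_eq // rkE.
    move/eqmxP => ->; rewrite -[v]scale1r -(mulVf a0) -scalerA -vG scalemx_sub //.
    exact: submxMl.
  have G'v : gram t g' *m v^T = 0.
    apply/matrixP => i j; rewrite (ord1 j) !mxE.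
    transitivity (ip (g' i) (w - ip u w *: u)).
      rewrite /w ipBr ipZr !ip_sumr mulr_suml -sumrB; apply: eq_bigr => s _.
      by rewrite !mxE /g' !(ipBr, ipZr); ring.
    by rewrite uw subrr ip0r.
  suff -> : \sum_s v 0 s ^+ 2 = 0 by rewrite ltxx.
  have := congr1 (fun M : 'M[R]__ => M 0 0) (congr1 (mulmx y) G'v).
  rewrite mulmx0 mulmxA -yE !mxE => v0'; rewrite -[RHS]v0'.
  by apply: eq_bigr => s _; rewrite mxE expr2.
have [e [l D]] := IHn g' (leq_trans lt_rk rk).
exists (u :: e), (a :: l).
have := spec_decomp_cons uu a0 _ _ D.
rewrite (_ : (fun h => _) = covop t g); last first.
  by apply/funext => h; rewrite V'E subrK.
apply.
- by rewrite V'E Vu uu mulr1 subrr.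
- move=> h; rewrite /covop ip_sumr big1 // => s _.
  by rewrite /rank_one ipZr ug' mulr0.
Qed.

Lemma sdecP A : (exists e l, spec_decomp ip A e l) ->
  spec_decomp ip A (sdec ip A).1 (sdec ip A).2.
Proof.
move=> [e [l D]].
exact: (xgetPex ([::], [::]) (ex_intro (fun p => spec_decomp ip A p.1 p.2) (e, l) D)).
Qed.

(** Split [h] into eigenvector coordinates [c_i] and a remainder [r] in the kernel of V: both sides
    equal [ip r r / rho] plus the sum of [c_i^2 / (rho + l_i)]. The inverse enters only through the
    equation for [b], so any construction of it can be plugged in. *)
Lemma norm_shift_inv_sqrt rho t g h b : 0 < rho ->
  rho *: b + covop t g b = h ->
  `|shift_inv_sqrt ip rho (covop t g) h| ^+ 2 = ip h b.
Proof.
move=> rho0 bh; have D := sdecP (covop_spec_decomp t g).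
rewrite (norm_ip) /shift_inv_sqrt /opfun addr0.
have [sz on nz Ae] := D; have nthD i := spec_decomp_nth (i := i) D.
move: sz on nz Ae nthD {D}; set e := (sdec _ _).1; set l := (sdec _ _).2.
move=> sz on nz Ae nthD.
pose E (i : 'I_(size e)) := nth 0 e i; pose L (i : 'I_(size e)) := nth 0 l i.
pose c i := ip (E i) h.
have onE i j : ip (E i) (E j) = (i == j)%:R by rewrite on.
have L0 i : 0 < rho + L i.
  rewrite ltr_pwDl //; have := covop_ge0 t g (E i).
  by rewrite nthD // ipZl // onE eqxx mulr1.
have ipE a i : ip (E i) (\sum_j a j *: E j) = a i.
  rewrite ip_sumr // (bigD1 i) //= ipZr // onE eqxx mulr1 big1 ?addr0 // => j ji.
  by rewrite ipZr // onE eq_sym (negbTE ji) mulr0.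
have ipEE x y a a' : (forall j, ip (E j) x = 0) -> (forall j, ip (E j) y = 0) ->
    ip (x + \sum_j a j *: E j) (y + \sum_j a' j *: E j) = ip x y + \sum_j a j * a' j.
  move=> xE yE; rewrite ipDl // !ipDr //.
  have -> : ip x (\sum_j a' j *: E j) = 0.
    by rewrite ip_sumr // big1 // => j _; rewrite ipZr // ipC // xE mulr0.
  rewrite addr0 !ip_suml // -big_split; congr (_ + _).
  by apply: eq_bigr => j _; rewrite /= !ipZl // yE ipE mulr0 add0r.
pose r := h - \sum_i c i *: E i.
have rE j : ip (E j) r = 0 by rewrite ipBr // ipE subrr.
have hE : h = r + \sum_i c i *: E i by rewrite subrK.
have -> : b = rho^-1 *: r + \sum_i ((rho + L i)^-1 * c i) *: E i.
  apply: (covop_shift_inj rho0 (t := t) (g := g)); rewrite bh Ae.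
  rewrite scalerDr scalerA mulfV ?gt_eqF // scale1r scaler_sumr -addrA -big_split /=.
  rewrite {1}hE; congr (_ + _); apply: eq_bigr => i _.
  rewrite ipDr // ipZr // rE ipE mulr0 add0r scalerA -scalerDl; congr (_ *: _).
  by have := L0 i; rewrite /L => ?; field; rewrite gt_eqF.
rewrite [X in ip X _ = _](_ : _ = (Num.sqrt rho)^-1 *: r +
    \sum_i ((Num.sqrt (rho + L i))^-1 * c i) *: E i) //.
rewrite [X in ip _ X = _](_ : _ = (Num.sqrt rho)^-1 *: r +
    \sum_i ((Num.sqrt (rho + L i))^-1 * c i) *: E i) //.
rewrite ipEE; try by move=> j; rewrite ipZr // rE mulr0.
rewrite {1}hE ipEE //; last by move=> j; rewrite ipZr // rE mulr0.
rewrite !ipZl // !ipZr // mulrA -expr2 exprVn sqr_sqrtr ?ltW //; congr (_ + _).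
apply: eq_bigr => i _; rewrite mulrACA -!expr2 exprVn sqr_sqrtr ?ltW //.
by rewrite expr2 mulrCA.
Qed.

(* Sherman-Morrison recursion for [(rho id + V_t)^-1]. *)
Fixpoint res (rho : R) (g : nat -> H) (t : nat) (h : H) : H :=
  if t is t'.+1 then
    let u := res rho g t' (g t') in
    res rho g t' h - (ip u h / (1 + ip (g t') u)) *: u
  else rho^-1 *: h.

(** Symmetry of V. Stated for arbitrary solutions, since the proof that [res] is the inverse uses it
    one index earlier. *)
Lemma shift_inverse_sym rho t g x y b b' :
  rho *: b + covop t g b = x -> rho *: b' + covop t g b' = y ->
  ip b y = ip x b'.
Proof.
move=> <- <-; rewrite ipDr // ipDl // ipZr // ipZl //.
by rewrite covop_sym.
Qed.

Lemma shift_inverse_ge0 rho t g x b : 0 < rho ->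
  rho *: b + covop t g b = x -> 0 <= ip x b.
Proof.
move=> rho0 <-; rewrite ipDl // ipZl // addr_ge0 ?covop_ge0 //.
by rewrite mulr_ge0 ?ip_ge0 // ltW.
Qed.

(** With [c] the Sherman-Morrison coefficient, the updated operator returns [h] plus
    [ip u h - c (1 + a)] times [g t], and [c = ip u h / (1 + a)] makes the extra term vanish. *)
Lemma resP rho g t h : 0 < rho ->
  rho *: res rho g t h + covop t g (res rho g t h) = h.
Proof.
move=> rho0; elim: t h => [|t IHt] h /=.
  by rewrite covop0 addr0 scalerA mulfV ?gt_eqF // scale1r.
set u := res rho g t (g t); set a := ip (g t) u.
have a0 : 1 + a != 0.
  by rewrite gt_eqF // ltr_pwDl // (shift_inverse_ge0 rho0 (IHt _)).
have uh : ip (g t) (res rho g t h) = ip u h.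
  by rewrite (shift_inverse_sym (IHt (g t)) (IHt h)).
rewrite covopS covopB covopZ scalerBr (scalerA rho) (mulrC rho) -(scalerA _ rho).
rewrite addrA addrACA -opprD -scalerDr !IHt ipBr // ipZr // uh -/a.
rewrite -addrA -scaleNr -scalerDl -[RHS]addr0 -[X in _ = _ + X](scale0r (g t)).
by congr (h + _ *: _); field.
Qed.

Lemma res_sym rho g t x y : 0 < rho -> ip (res rho g t x) y = ip x (res rho g t y).
Proof. by move=> rho0; exact: (shift_inverse_sym (resP _ _ _ rho0) (resP _ _ _ rho0)). Qed.

Lemma res_ge0 rho g t x : 0 < rho -> 0 <= ip x (res rho g t x).
Proof. by move=> rho0; exact: (shift_inverse_ge0 rho0 (resP _ _ _ rho0)). Qed.

Lemma resD rho g t x y : 0 < rho ->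
  res rho g t (x + y) = res rho g t x + res rho g t y.
Proof.
move=> rho0; apply: (covop_shift_inj rho0 (t := t) (g := g)).
by rewrite resP // covopD // scalerDr addrACA !resP.
Qed.

Lemma resZ rho g t a x : 0 < rho -> res rho g t (a *: x) = a *: res rho g t x.
Proof.
move=> rho0; apply: (covop_shift_inj rho0 (t := t) (g := g)).
by rewrite resP // covopZ // scalerA mulrC -scalerA -scalerDr resP.
Qed.

(** The old form gains [2 y b + y^2 a] by bilinearity and loses [(b + y a)^2 / (1 + a)] by
    Sherman-Morrison; the difference collapses to the stated fraction. *)
Lemma res_quad_step rho g t S y : 0 < rho ->
  let a := ip (g t) (res rho g t (g t)) in
  let b := ip (g t) (res rho g t S) in
  ip (S + y *: g t) (res rho g t.+1 (S + y *: g t)) =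
  ip S (res rho g t S) + (2 * y * b + y ^+ 2 * a - b ^+ 2) / (1 + a).
Proof.
move=> rho0 a b.
have a0 : 1 + a != 0 by rewrite gt_eqF // ltr_pwDl // res_ge0.
have Sb : ip S (res rho g t (g t)) = b by rewrite -res_sym // ipC.
rewrite [res _ _ _.+1 _]/= -/a resD // resZ // ipBr // ipZr // !(ipDl, ipDr, ipZl, ipZr) //.
rewrite !(ipC (res rho g t (g t))) -/a -/b !Sb.
by field.
Qed.

(** In eigenvector coordinates [rho id + V_t] is diagonal with entries [rho (1 + l_j)]. The same
    matrix is built one vector at a time, each contributing a factor by the determinant lemma.
    Comparing the two determinants and cancelling the power of [rho] gives the formula. *)
Lemma fdet_covop rho g t : 0 < rho ->
  fdet ip (fun h => rho^-1 *: covop t g h) =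
  \prod_(s < t) (1 + ip (g s) (res rho g s (g s))).
Proof.
move=> rho0; have rN0 : rho != 0 by rewrite gt_eqF.
have [e0 [l0 D0]] := covop_spec_decomp t g.
have D : spec_decomp ip (fun h => rho^-1 *: covop t g h) _ _ :=
  sdecP (ex_intro _ _ (ex_intro _ _ (spec_decomp_scale (invr_neq0 rN0) D0))).
rewrite /fdet; have [sz on nz Ae] := D; have nthD i := spec_decomp_nth (i := i) D.
move: sz on nz Ae nthD {D e0 l0 D0}; set e := (sdec _ _).1; set l := (sdec _ _).2.
move=> sz on nz Ae nthD.
pose E (i : 'I_(size e)) := nth 0 e i.
have onE i j : ip (E i) (E j) = (i == j)%:R by rewrite on.
have ipE a i : ip (E i) (\sum_j a j *: E j) = a i.
  rewrite ip_sumr // (bigD1 i) //= ipZr // onE eqxx mulr1 big1 ?addr0 // => j ji.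
  by rewrite ipZr // onE eq_sym (negbTE ji) mulr0.
(* Each [g s] with [s < t] lies in the span of the eigenvectors: V kills the residue [r], so the
   squares of [ip (g i) r] sum to 0. *)
have gE (s : 'I_t) : g s = \sum_j ip (E j) (g s) *: E j.
  apply/eqP; rewrite -subr_eq0; apply/eqP; set r := _ - _.
  have rE j : ip (E j) r = 0 by rewrite ipBr // ipE subrr.
  have : covop t g r = 0.
    apply: (scalerI (invr_neq0 rN0)); rewrite scaler0 Ae big1 // => i _.
    by rewrite rE mulr0 scale0r.
  move/(congr1 (ip^~ r)); rewrite ip_covop // ip0l // => /psumr_eq0P sr.
  have gr : ip (g s) r = 0.
    by apply/eqP; rewrite -sqrf_eq0 expr2 sr // => i _; rewrite -expr2 sqr_ge0.
  apply: (ip_eq0); rewrite {1}/r ipBl // gr ip_suml // big1 ?subr0 // => j _.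
  by rewrite ipZl // rE mulr0.
pose C h : 'cV[R]_(size e) := \col_i ip (E i) h.
have CD x y : C (x + y) = C x + C y by apply/matrixP => i j; rewrite !mxE ipDr.
have CZ a x : C (a *: x) = a *: C x by apply/matrixP => i j; rewrite !mxE ipZr.
have Cg (s : 'I_t) h : (C (g s))^T *m C h = (ip (g s) h)%:M.
  apply/matrixP => i j; rewrite !ord1 !mxE eqxx mulr1n {2}gE ip_suml //.
  by apply: eq_bigr => k _; rewrite !mxE ipZl.
pose W t' := rho%:M + \sum_(s < t') C (g s) *m (C (g s))^T.
have WS t' : W t'.+1 = W t' + C (g t') *m (C (g t'))^T.
  by rewrite /W big_ord_recr addrA.
have WC t' h : (t' <= t)%N -> W t' *m C h = C (rho *: h + covop t' g h).
  elim: t' => [_|t' IHt' lt].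
    by rewrite /W big_ord0 addr0 mul_scalar_mx covop0 addr0 CZ.
  rewrite WS mulmxDl IHt' 1?ltnW // -mulmxA (Cg (Ordinal lt)) mul_mx_scalar.
  by rewrite covopS addrA !CD !CZ.
have detW t' : (t' <= t)%N -> \det (W t') =
    rho ^+ size e * \prod_(s < t') (1 + ip (g s) (res rho g s (g s))).
  elim: t' => [_|t' IHt' lt]; first by rewrite /W !big_ord0 addr0 mulr1 det_scalar.
  (* Since [C (g t')] is [W t'] applied to the coordinates of [res], the matrix [W t'] factors out
     on the left; what remains is the identity plus a column times a row. *)
  rewrite WS -{1}(resP g t' (g t') rho0) -WC 1?ltnW //.
  rewrite -mulmxA -{1}[W t']mulmx1 -mulmxDr det_mulmx IHt' 1?ltnW //.
  rewrite det_1DmulmxC (Cg (Ordinal lt)) det_mx11 !mxE eqxx !mulr1n big_ord_recr.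
  by rewrite mulrA.
have Wdiag : W t = diag_mx (\row_j (rho * (1 + nth 0 l j))).
  apply/matrixP => i j; rewrite !mxE summxE mulrDr mulr1.
  transitivity (rho *+ (i == j) + ip (covop t g (E i)) (E j)).
    congr (_ + _); rewrite ip_covop //; apply: eq_bigr => s _.
    by rewrite !mxE big_ord1 !mxE ![ip (g s) _]ipC.
  rewrite -[covop t g (E i)](scalerK (invr_neq0 rN0)) invrK nthD // !ipZl // onE.
  by case: eqVneq => [->|_]; rewrite ?mulr1n ?mulr1 ?mulr0n ?mulr0 ?addr0.
apply: (mulfI (expf_neq0 (size e) rN0)); rewrite -detW // Wdiag det_diag.
rewrite (big_nth 0) big_mkord -sz -[X in rho ^+ X]card_ord -prodr_const -big_split.
by apply: eq_bigr => i _; rewrite mxE.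
Qed.

End InnerProduct.

(** * Measurability with respect to a sub-sigma-algebra *)

Section SubSigmaMeasurable.
Context {d : measure_display} {T : measurableType d} {R : realType}.
Context (G : set_system T) (sG : sigma_algebra setT G).

(** The sigma-algebra generated by [G] is [G] itself, so facts about measurable functions on a
    measurable space carry over to [G]. *)
Lemma rmeasP (X : T -> R) :
  rmeas G X <-> measurable_fun [set: g_sigma_algebraType G] X.
Proof.
have mG : (measurable : set (set (g_sigma_algebraType G))) = G.
  exact: measurable_g_measurableTypeE.
split=> [mX _ B mB|mX B mB].
  by rewrite setTI mG; exact: mX.
by have := mX measurableT B mB; rewrite setTI mG.
Qed.

Lemma sigma_algebra_setI A B : G A -> G B -> G (A `&` B).
Proof.
rewrite -(measurable_g_measurableTypeE sG).
exact: measurableI.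
Qed.

Lemma rmeas_comp (h : R -> R) (X : T -> R) :
  measurable_fun setT h -> rmeas G X -> rmeas G (h \o X).
Proof. by move=> mh /rmeasP mX; apply/rmeasP; exact: measurableT_comp. Qed.

Lemma rmeas_cst (c : R) : rmeas G (fun=> c).
Proof. by apply/rmeasP. Qed.

Lemma rmeasD X Y : rmeas G X -> rmeas G Y -> rmeas G (fun x => X x + Y x : R).
Proof. by move=> /rmeasP mX /rmeasP mY; apply/rmeasP; exact: measurable_funD. Qed.

Lemma rmeasM X Y : rmeas G X -> rmeas G Y -> rmeas G (fun x => X x * Y x : R).
Proof. by move=> /rmeasP mX /rmeasP mY; apply/rmeasP; exact: measurable_funM. Qed.

Lemma rmeasB X Y : rmeas G X -> rmeas G Y -> rmeas G (fun x => X x - Y x : R).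
Proof. by move=> /rmeasP mX /rmeasP mY; apply/rmeasP; exact: measurable_funB. Qed.

Lemma rmeas_sum n (X : nat -> T -> R) : (forall i, (i < n)%N -> rmeas G (X i)) ->
  rmeas G (fun x => \sum_(i < n) X i x).
Proof.
elim: n => [_|n IHn mX].
  rewrite (_ : (fun=> _) = fun=> 0); first exact: rmeas_cst.
  by apply/funext => x; rewrite big_ord0.
rewrite (_ : (fun x => _) = fun x => \sum_(i < n) X i x + X n x); last first.
  by apply/funext => x; rewrite big_ord_recr.
by apply: rmeasD; [apply: IHn => i ?; apply: mX; exact: ltnW|exact: mX].
Qed.

Lemma rmeas_expR X : rmeas G X -> rmeas G (fun x => expR (X x) : R).
Proof. exact: (rmeas_comp (h := expR)). Qed.

Lemma rmeas_sqrt X : rmeas G X -> rmeas G (fun x => Num.sqrt (X x) : R).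
Proof.
apply: (rmeas_comp (h := Num.sqrt)).
by apply: continuous_measurable_fun; exact: sqrt_continuous.
Qed.

Lemma rmeas_inv X : (forall x, 0 < X x) -> rmeas G X -> rmeas G (fun x => (X x)^-1 : R).
Proof.
move=> X0 mX; rewrite (_ : (fun x => _) = fun x => expR (-1 * ln (X x))); last first.
  by apply/funext => x; rewrite mulN1r expRN lnK // posrE.
apply: rmeas_expR; apply: rmeasM; first exact: rmeas_cst.
by apply: (rmeas_comp (h := @ln R)) => //; exact: measurable_ln.
Qed.

Lemma rmeas_indicM A X : G A -> rmeas G X -> rmeas G (fun x => \1_A x * X x : R).
Proof.
move=> GA mX; apply: rmeasM => //; apply/rmeasP/measurable_indic.
by rewrite measurable_g_measurableTypeE.
Qed.

End SubSigmaMeasurable.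

Lemma rmeas_sub d (T : measurableType d) (R : realType) (F G : set_system T) (X : T -> R) :
  F `<=` G -> rmeas F X -> rmeas G X.
Proof. by move=> FG mX B mB; apply: FG; exact: mX. Qed.

Lemma measurable_rmeas d (T : measurableType d) (R : realType) (G : set_system T) (X : T -> R) :
  G `<=` measurable -> rmeas G X -> measurable_fun setT X.
Proof. by move=> Gm mX _ B mB; rewrite setTI; apply: Gm; exact: mX. Qed.

(** * Rounding down to a countable grid *)

Section Discretization.
Context {R : realType}.

(** Rounds to a multiple of [1 / (n + 1)], downwards so that a rounded weight stays below the
    original one. *)
Definition dfloor (n : nat) (y : R) : R := (Num.floor (n.+1%:R * y))%:~R / n.+1%:R.

Lemma measurable_floor_eq (k : int) : measurable [set y : R | Num.floor y = k].
Proof.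
rewrite (_ : [set _ | _] = `[k%:~R, (k + 1)%:~R[%classic) //.
apply/seteqP; split => y /=; rewrite in_itv /=.
  by move=> <-; rewrite floor_le /= floorD1_gt.
by move=> /floor_def.
Qed.

Lemma measurable_floorR : measurable_fun setT (fun y : R => (Num.floor y)%:~R : R).
Proof.
move=> _ B mB; rewrite setTI.
rewrite (_ : _ @^-1` _ = \bigcup_k [set y | Num.floor y = k /\ B k%:~R]).
  apply: countable_bigcupT_measurable => [|k]; first exact: countableP.
  have [Bk|Bk] := pselect (B k%:~R).
    rewrite (_ : [set _ | _] = [set y | Num.floor y = k]).
      exact: measurable_floor_eq.
    by apply/seteqP; split => y /=; [case|split].
  by rewrite (_ : [set _ | _] = set0) //; apply/seteqP; split => y //= [].
by apply/seteqP; split => [y /= By|y [k _ [/= <-]]]; [exists (Num.floor y)|].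
Qed.

Lemma measurable_dfloor n : measurable_fun setT (dfloor n).
Proof.
apply: measurable_funM => //.
by apply: (measurableT_comp measurable_floorR); exact: measurable_funM.
Qed.

Lemma dfloor_le n y : dfloor n y <= y.
Proof. by rewrite ler_pdivrMr // mulrC floor_le. Qed.

Lemma dfloor_ge0 n y : 0 <= y -> 0 <= dfloor n y.
Proof.
move=> y0; rewrite divr_ge0 // ler0z floor_ge0.
by rewrite mulr_ge0.
Qed.

Lemma cvg_dfloor y : dfloor n y @[n --> \oo] --> y.
Proof.
apply: (@squeeze_cvgr _ _ _ _ (fun n => y - harmonic n) (fun=> y)).
- apply: nearW => n; rewrite dfloor_le andbT /dfloor ler_pdivlMr // mulrBl.
  rewrite /harmonic mulVf // lerBlDr (le_trans (ltW (floorD1_gt _))) //.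
  by rewrite mulrC intrD.
- rewrite -[X in _ --> X]subr0; apply: cvgB; [exact: cvg_cst|exact: cvg_harmonic].
- exact: cvg_cst.
Qed.

End Discretization.

(** Completing the square turns the integrand into a constant times the normal density of mean [m]
    and variance [1 / (1 + a)]. Writing [l = b + sqrt a z] with [z] standard normal also covers
    [a = 0]. *)
Lemma gaussian_mixture (R : realType) (a b y : R) : 0 <= a ->
  (\int[lebesgue_measure]_z
     (expR ((b + Num.sqrt a * z) * y - (b + Num.sqrt a * z) ^+ 2 / 2) *
      normal_pdf 0 1 z)%:E)%E =
  ((Num.sqrt (1 + a))^-1 *
   expR (2^-1 * ((2 * y * b + y ^+ 2 * a - b ^+ 2) / (1 + a))))%:E.
Proof.
move=> a0; have a1 : 0 < 1 + a by rewrite ltr_pwDl.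
have s0 : Num.sqrt (1 + a) != 0 by rewrite gt_eqF // sqrtr_gt0.
set s := (Num.sqrt (1 + a))^-1; set K := expR _.
pose m := Num.sqrt a * (y - b) / (1 + a).
have K0 : 0 <= s * K by rewrite mulr_ge0 ?expR_ge0 // invr_ge0 sqrtr_ge0.
transitivity (\int[lebesgue_measure]_z ((s * K)%:E * (normal_pdf m s z)%:E))%E; last first.
  rewrite ge0_integralZl_EFin // ?integral_normal_pdf ?mule1 //.
  - by move=> z _; rewrite lee_fin normal_pdf_ge0.
  - by apply/measurable_EFinP; exact: measurable_normal_pdf.
apply: eq_integral => z _; rewrite -EFinM; congr (_%:E).
rewrite !normal_pdfE ?oner_eq0 ?invr_neq0 // /normal_peak /normal_fun subr0.
have ss : s ^+ 2 = (1 + a)^-1 by rewrite exprVn sqr_sqrtr // ltW.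
have -> : (Num.sqrt (1 ^+ 2 * pi *+ 2))^-1 = s * (Num.sqrt (s ^+ 2 * pi *+ 2))^-1 :> R.
  rewrite expr1n mul1r -mulrnAr sqrtrM ?sqr_ge0 // sqrtr_sqr ger0_norm.
    by rewrite invfM mulrA mulfV ?mul1r // invr_neq0.
  by rewrite invr_ge0 sqrtr_ge0.
rewrite mulrCA -expRD mulrACA -expRD; congr (_ * expR _); rewrite ss expr1n /m.
rewrite -[(1 + a)^-1 *+ 2]mulr_natr -[1 *+ 2 in LHS]mulr_natr.
set r := Num.sqrt a; have ar : a = r ^+ 2 by rewrite sqr_sqrtr.
have : 1 + r ^+ 2 != 0 by rewrite gt_eqF // ltr_pwDl // sqr_ge0.
by rewrite ar => ?; field.
Qed.

(** * The conditional Gaussian mixture bound *)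

Section ConditionalMixture.
Context {d : measure_display} {T : measurableType d} {R : realType}.
Context (P : probability T R) (G : set_system T) (Y : T -> R).
Context (sG : sigma_algebra setT G) (Gm : G `<=` measurable).
Context (mY : measurable_fun setT Y).
Context (subG : forall c A, G A ->
  (\int[P]_(x in A) (expR (c * Y x))%:E <= \int[P]_(x in A) (expR (c ^+ 2 / 2))%:E)%E).

(** The case of a constant multiplier, applied later cell by cell: [exp (- c^2 / 2)] comes out of
    the integral and cancels the sub-Gaussian bound. *)
Lemma const_exp_le (w c : R) A : G A -> 0 <= w ->
  (\int[P]_(x in A) (w * expR (c * Y x - c ^+ 2 / 2))%:E <=
   \int[P]_(x in A) w%:E)%E.
Proof.
move=> GA w0; have mA := Gm GA; set k := w * expR (- (c ^+ 2 / 2)).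
have k0 : 0 <= k by rewrite mulr_ge0 ?expR_ge0.
under eq_integral do rewrite addrC expRD mulrA -/k EFinM.
rewrite ge0_integralZl_EFin //; last first.
  apply/measurable_EFinP/measurable_funTS/(measurableT_comp (@measurable_expR R)).
  exact: measurable_funM.
apply: (@le_trans _ _ (k%:E * \int[P]_(x in A) (expR (c ^+ 2 / 2))%:E)%E).
  by apply: lee_wpmul2l; [rewrite lee_fin|exact: subG].
rewrite -ge0_integralZl_EFin //.
by under eq_integral do rewrite -EFinM /k -mulrA -expRD addNr expR0 mulr1.
Qed.

(* On each cell of a countable G-measurable partition the discretized [W] and [L]
   are constant, so the hypothesis applies; Fatou removes the discretization. *)
Lemma weighted_exp_le (W L : T -> R) :
  rmeas G W -> rmeas G L -> (forall x, 0 <= W x) ->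
  (\int[P]_x (W x * expR (L x * Y x - L x ^+ 2 / 2))%:E <= \int[P]_x (W x)%:E)%E.
Proof.
move=> mW mL W0.
pose W_ n x := dfloor n (W x); pose L_ n x := dfloor n (L x).
pose f n x := W_ n x * expR (L_ n x * Y x - L_ n x ^+ 2 / 2).
have mW_ n : measurable_fun setT (W_ n).
  by apply: (measurable_rmeas Gm); apply: (rmeas_comp sG (h := dfloor n)) => //; exact: measurable_dfloor.
have mL_ n : measurable_fun setT (L_ n).
  by apply: (measurable_rmeas Gm); apply: (rmeas_comp sG (h := dfloor n)) => //; exact: measurable_dfloor.
have mf n : measurable_fun setT (EFin \o f n).
  apply/measurable_EFinP; apply: measurable_funM => //.
  apply: (measurableT_comp (@measurable_expR R)).
  apply: measurable_funB; first exact: measurable_funM.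
  by apply: measurable_funM => //; exact: measurable_funX.
have f0 n x : 0 <= f n x by rewrite mulr_ge0 ?expR_ge0 // dfloor_ge0.
have cvgf x : (f n x)%:E @[n --> \oo] -->
    (W x * expR (L x * Y x - L x ^+ 2 / 2))%:E.
  apply/cvg_EFin; first by near=> n.
  apply: cvgM; first exact: cvg_dfloor.
  apply: cvg_comp; last exact: continuous_expR.
  apply: cvgB; first by apply: cvgM; [exact: cvg_dfloor|exact: cvg_cst].
  apply: cvgM; last exact: cvg_cst.
  under eq_fun do rewrite expr2.
  by rewrite expr2; apply: cvgM; exact: cvg_dfloor.
have le_f n : (\int[P]_x (f n x)%:E <= \int[P]_x (W x)%:E)%E.
  (* [pickle] encodes the two integer grid positions as one natural number, so the cells form a
     sequence; its injectivity recovers both roundings on a cell. *)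
  pose c x := pickle (Num.floor (n.+1%:R * W x), Num.floor (n.+1%:R * L x)).
  pose cell k := [set x | c x = k].
  have Gcell k : G (cell k).
    have [[x0 cx0]|no] := pselect (exists x0, c x0 = k); last first.
      rewrite (_ : cell k = set0); first by case: sG.
      by apply/seteqP; split => x //= cx; apply: no; exists x.
    pose fl (X : T -> R) := [set x | Num.floor (n.+1%:R * X x) = Num.floor (n.+1%:R * X x0)].
    have Gfl X : rmeas G X -> G (fl X).
      move=> mX.
      exact: (rmeasM sG (rmeas_cst sG n.+1%:R) mX (measurable_floor_eq _)).
    rewrite (_ : cell k = fl W `&` fl L).
      by apply: (sigma_algebra_setI sG); exact: Gfl.
    apply/seteqP; split => x /=.
      by rewrite /cell /= -cx0 => /(pcan_inj pickleK)[].
    by case; rewrite /fl /cell /= -cx0 /c => -> ->.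
  have cellT : \bigcup_k cell k = setT by apply/seteqP; split => x // _; exists (c x).
  have tcell : trivIset setT cell by move=> i j _ _ [x []] <- <-.
  apply: (@le_trans _ _ (\int[P]_x (W_ n x)%:E)%E); last first.
    apply: ge0_le_integral => //.
    - by move=> x _; rewrite lee_fin dfloor_ge0.
    - exact/measurable_EFinP.
    - by apply/measurable_EFinP; exact: (measurable_rmeas Gm).
    - by move=> x _; rewrite lee_fin dfloor_le.
  have splitE (h : T -> R) : measurable_fun setT h -> (forall x, 0 <= h x) ->
      (\int[P]_x (h x)%:E = \sum_(k <oo) \int[P]_(x in cell k) (h x)%:E)%E.
    move=> mh h0; rewrite -[in LHS]cellT ge0_integral_bigcup // ?cellT.
    - by move=> k; exact: Gm.
    - exact/measurable_EFinP.
    - by move=> x _; rewrite lee_fin.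
  have mfn : measurable_fun setT (f n) by apply/measurable_EFinP; exact: mf.
  rewrite !splitE // => [|x]; last exact: dfloor_ge0.
  apply: lee_nneseries => [k _ _|k _].
    by apply: integral_ge0 => x _; rewrite lee_fin f0.
  have [[x0 cx0]|no] := pselect (exists x0, c x0 = k); last first.
    rewrite (_ : cell k = set0) ?integral_set0 //.
    by apply/seteqP; split => x //= cx; apply: no; exists x.
  have cellE x : x \in cell k -> W_ n x = W_ n x0 /\ L_ n x = L_ n x0.
    rewrite inE /cell /= -cx0 => /(pcan_inj pickleK)[eW eL].
    by rewrite /W_ /L_ /dfloor eW eL.
  have -> : (\int[P]_(x in cell k) (f n x)%:E = \int[P]_(x in cell k)
      (W_ n x0 * expR (L_ n x0 * Y x - L_ n x0 ^+ 2 / 2))%:E)%E.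
    by apply: eq_integral => x /cellE[eW eL]; rewrite /f eW eL.
  have -> : (\int[P]_(x in cell k) (W_ n x)%:E = \int[P]_(x in cell k) (W_ n x0)%:E)%E.
    by apply: eq_integral => x /cellE[-> _].
  exact: const_exp_le (Gcell k) (dfloor_ge0 n (W0 x0)).
rewrite (eq_integral (fun x => limn_einf (fun n => (f n x)%:E))); last first.
  by move=> x _; rewrite (cvg_limn_einf_sup (cvgf x)).1.
apply: (le_trans (fatou _ _ mf _)) => //; first by move=> n x _; rewrite lee_fin.
rewrite limn_einf_lim; apply: lime_le; first exact: is_cvg_einfs.
by apply: nearW => n; apply: le_trans (le_f n); apply: ereal_inf_lbound; exists n => /=.
Unshelve. all: by end_near.
Qed.

(** For each fixed [z] the multiplier [b + sqrt a z] is [G]-measurable, so [weighted_exp_le] applies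
    under the outer integral once Tonelli has exchanged the two. *)
Lemma mixture_le (W a b : T -> R) :
  rmeas G W -> rmeas G a -> rmeas G b -> (forall x, 0 <= W x) -> (forall x, 0 <= a x) ->
  (\int[P]_x (W x * ((Num.sqrt (1 + a x))^-1 *
     expR (2^-1 * ((2 * Y x * b x + Y x ^+ 2 * a x - b x ^+ 2) / (1 + a x)))))%:E
   <= \int[P]_x (W x)%:E)%E.
Proof.
move=> mW ma mb W0 a0.
pose L z x := b x + Num.sqrt (a x) * z.
pose f (p : T * R) := (W p.1 * expR (L p.2 p.1 * Y p.1 - L p.2 p.1 ^+ 2 / 2) *
  normal_pdf 0 1 p.2)%:E.
have mW' := measurable_rmeas Gm mW; have mb' := measurable_rmeas Gm mb.
have msa := measurable_rmeas Gm (rmeas_sqrt sG ma).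
have f0 p : (0 <= f p)%E.
  by rewrite lee_fin !mulr_ge0 ?expR_ge0 ?normal_pdf_ge0.
have m1 (h : T -> R) : measurable_fun setT h ->
    measurable_fun setT (fun p : T * R => h p.1).
  by move=> mh; exact: (measurableT_comp mh measurable_fst).
have m2 (h : R -> R) : measurable_fun setT h ->
    measurable_fun setT (fun p : T * R => h p.2).
  by move=> mh; exact: (measurableT_comp mh measurable_snd).
have mL : measurable_fun setT (fun p : T * R => L p.2 p.1).
  by apply: measurable_funD; [exact: m1|apply: measurable_funM; [exact: (m1 (fun x => Num.sqrt (a x)))|exact: (m2 id)]].
have mf : measurable_fun setT f.
  apply/measurable_EFinP; apply: measurable_funM; last first.
    by apply: m2; exact: measurable_normal_pdf.
  apply: measurable_funM; first exact: m1.
  apply: (measurableT_comp (@measurable_expR R)); apply: measurable_funB.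
    by apply: measurable_funM => //; exact: m1.
  by apply: measurable_funM => //; exact: measurable_funX.
have -> : (\int[P]_x (W x * ((Num.sqrt (1 + a x))^-1 *
     expR (2^-1 * ((2 * Y x * b x + Y x ^+ 2 * a x - b x ^+ 2) / (1 + a x)))))%:E =
    \int[P]_x \int[lebesgue_measure]_z f (x, z))%E.
  apply: eq_integral => x _; rewrite EFinM -gaussian_mixture //.
  rewrite -ge0_integralZl_EFin //.
  - by apply: eq_integral => z _; rewrite -EFinM mulrA.
  - by move=> z _; rewrite lee_fin mulr_ge0 ?expR_ge0 ?normal_pdf_ge0.
  - apply/measurable_EFinP; apply: measurable_funM; last exact: measurable_normal_pdf.
    apply: (measurableT_comp (@measurable_expR R)).
    have mLx : measurable_fun setT (L ^~ x).
      by apply: measurable_funD => //; exact: measurable_funM.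
    apply: measurable_funB; first exact: measurable_funM.
    by apply: measurable_funM => //; exact: measurable_funX.
rewrite fubini_tonelli //.
apply: (@le_trans _ _ (\int[lebesgue_measure]_z
    ((\int[P]_x (W x)%:E) * (normal_pdf 0 1 z)%:E))%E).
  apply: ge0_le_integral => //.
  - by move=> z _; apply: integral_ge0.
  - exact: measurable_fun_fubini_tonelli_G.
  - apply: emeasurable_funM => //.
    by apply/measurable_EFinP; exact: measurable_normal_pdf.
  - move=> z _.
    have mLz : rmeas G (L z).
      by apply: rmeasD => //; apply: rmeasM => //; [exact: rmeas_sqrt|exact: rmeas_cst].
    have mLz' := measurable_rmeas Gm mLz.
    have -> : (\int[P]_x f (x, z) = (normal_pdf 0 1 z)%:E *
       \int[P]_x (W x * expR (L z x * Y x - L z x ^+ 2 / 2))%:E)%E.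
      rewrite -ge0_integralZl_EFin ?normal_pdf_ge0 //.
      + by apply: eq_integral => x _; rewrite -EFinM mulrC.
      + by move=> x _; rewrite lee_fin mulr_ge0 ?expR_ge0.
      + apply/measurable_EFinP; apply: measurable_funM => //.
        apply: (measurableT_comp (@measurable_expR R)).
        apply: measurable_funB; first exact: measurable_funM.
        by apply: measurable_funM => //; exact: measurable_funX.
    rewrite muleC; apply: lee_wpmul2r; first by rewrite lee_fin normal_pdf_ge0.
    exact: weighted_exp_le.
rewrite ge0_integralZl //.
- by rewrite integral_normal_pdf mule1.
- by apply/measurable_EFinP; exact: measurable_normal_pdf.
- by move=> z _; rewrite lee_fin normal_pdf_ge0.
- by apply: integral_ge0 => x _; rewrite lee_fin.
Qed.

End ConditionalMixture.

(** * Measurability of inner products in a separable space *)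

Section SeparableMeasurability.
Context {d : measure_display} {T : measurableType d} {R : realType}.
Context {H : normedModType R} (ip : H -> H -> R) (ipP : is_inner_product ip).
Context (D : set H) (cD : countable D) (dD : closure D = setT).
Context (G : set_system T) (sG : sigma_algebra setT G).

(** Separability yields a countable union: [|u - v| < r] iff, for some [n], a point of [D] is within
    [1 / (n + 1)] of [u] and within [r - 1 / (n + 1)] of [v]. *)
Lemma rmeas_dist (u v : T -> H) : hmeas G u -> hmeas G v ->
  rmeas G (fun x => `|u x - v x|).
Proof.
move=> mu mv; have GE := measurable_g_measurableTypeE sG.
(* The radius [r - 1 / (n + 1)] may fail to be positive; the ball is then empty. *)
have mball w a e : hmeas G w -> G (w @^-1` ball (a : H) e).
  move=> mw; have [e0|e0] := ltP 0 e; first by apply: mw; exact: ball_open.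
  rewrite (_ : _ @^-1` _ = set0); first by case: sG.
  apply/seteqP; split => x //=; rewrite -ball_normE /= => /(le_lt_trans (normr_ge0 _)).
  by rewrite ltNge e0.
have lt_meas (r : R) : G [set x | `|u x - v x| < r].
  rewrite (_ : [set _ | _] = \bigcup_(p : D * nat)
     (u @^-1` ball (val p.1) (p.2.+1%:R^-1) `&` v @^-1` ball (val p.1) (r - p.2.+1%:R^-1))).
    rewrite -GE; apply: countable_bigcupT_measurable.
      rewrite -setXTT; apply: countableX; last exact: countableP.
      by rewrite (eq_countable (card_setT D)).
    move=> p; rewrite GE; apply: sigma_algebra_setI => //.
    - exact: mball.
    - exact: mball.
  apply/seteqP; split => x /=.
    (* [n] is taken with [2 / (n + 1) < r - |u - v|], which leaves room for the triangle
       inequality. *)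
    move=> uv; have : 0 < (r - `|u x - v x|) / 2 by rewrite divr_gt0 // subr_gt0.
    move=> /ltr_add_invr[n]; rewrite add0r => nr.
    have : closure D (u x) by rewrite dD.
    move=> /(_ _ (nbhsx_ballx _ _ (_ : 0 < n.+1%:R^-1))) [] // a [Da].
    rewrite -ball_normE /= => ua.
    exists (exist _ a (mem_set Da), n) => //=; split.
      by rewrite distrC.
    have := ler_distD (u x) a (v x); rewrite (distrC a (u x)) => tri.
    move: (n.+1%:R^-1) nr ua => e nr ua; lra.
  move=> [[[a Da] n] _ /= []]; rewrite -!ball_normE /= => ua va.
  have := ler_distD a (u x) (v x); move/le_lt_trans; apply.
  by rewrite -(subrK (n.+1%:R^-1) r) addrC (distrC (u x)) ltrD.
apply/rmeasP => //; apply: (measurability _ (RGenCInfty.measurableE R)).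
move=> _ [_ [r ->] <-]; rewrite setTI.
rewrite (_ : _ @^-1` _ = ~` [set x | `|u x - v x| < r]).
  by apply: measurableC; rewrite GE.
by apply/seteqP; split => x /=; rewrite in_itv /= andbT ?leNgt => /negP.
Qed.

(** Polarization: [ip u v] is half of [|u|^2 + |v|^2 - |u - v|^2], with [|u|] read as the distance
    to the constant 0. *)
Lemma rmeas_ip (u v : T -> H) : hmeas G u -> hmeas G v ->
  rmeas G (fun x => ip (u x) (v x)).
Proof.
move=> mu mv; have m0 : hmeas G (fun=> 0 : H).
  move=> U _; have [U0|U0] := pselect (U 0).
    rewrite (_ : _ @^-1` _ = setT) //; last by apply/seteqP; split.
    by rewrite -[G](measurable_g_measurableTypeE sG); exact: measurableT.
  rewrite (_ : _ @^-1` _ = set0); first by case: sG.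
  by apply/seteqP; split.
have mN (w : T -> H) : hmeas G w -> rmeas G (fun x => `|w x - 0| * `|w x - 0|).
  by move=> mw; apply: rmeasM => //; exact: (rmeas_dist mw m0).
rewrite (_ : (fun x => _) = fun x => 2^-1 * (`|u x - 0| * `|u x - 0| +
    `|v x - 0| * `|v x - 0| - `|u x - v x| * `|u x - v x|)).
  apply: rmeasM => //; first exact: rmeas_cst.
  by apply: rmeasB => //; [apply: rmeasD => //; exact: mN|apply: rmeasM => //; exact: (rmeas_dist mu mv)].
apply/funext => x; rewrite !subr0 -!expr2 !(norm_ip ipP).
rewrite (ipBl ipP) !(ipBr ipP) (ipC ipP (v x) (u x)).
by field.
Qed.

(** All pairs are treated at once, because a Sherman-Morrison step for [(i, j)] calls on [(t, j)],
    [(t, t)] and [(i, t)]. The recursion stays among scalar functions. *)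
Lemma rmeas_ip_res rho m (g : nat -> T -> H) : 0 < rho ->
  (forall s, (s < m)%N -> hmeas G (g s)) ->
  forall t i j, (t <= m)%N -> (i < m)%N -> (j < m)%N ->
  rmeas G (fun x => ip (g i x) (res ip rho (g ^~ x) t (g j x))).
Proof.
move=> rho0 mg; elim=> [|t IHt] i j tm im jm.
  rewrite (_ : (fun x => _) = fun x => rho^-1 * ip (g i x) (g j x)).
    by apply: rmeasM => //; [exact: rmeas_cst|apply: rmeas_ip; exact: mg].
  by apply/funext => x; rewrite /= (ipZr ipP).
pose q i j x := ip (g i x) (res ip rho (g ^~ x) t (g j x)).
have mq i' j' : (i' < m)%N -> (j' < m)%N -> rmeas G (q i' j').
  by move=> *; apply: IHt => //; exact: ltnW.
rewrite (_ : (fun x => _) = fun x => q i j x - q t j x * (1 + q t t x)^-1 * q i t x).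
  apply: rmeasB => //; first exact: mq.
  apply: rmeasM => //; last exact: mq.
  apply: rmeasM => //; first exact: mq.
  apply: rmeas_inv => //.
    by move=> x; rewrite ltr_pwDl // /q (res_ge0 ipP).
  by apply: rmeasD => //; [exact: rmeas_cst|exact: mq].
by apply/funext => x; rewrite /= (ipBr ipP) (ipZr ipP) /q (res_sym ipP).
Qed.

End SeparableMeasurability.

(** * Ville's maximal inequality *)

Section Ville.
Context {d : measure_display} {T : measurableType d} {R : realType}.
Context (P : probability T R) (F : nat -> set_system T) (M : nat -> T -> R).
Context (fF : filtration F) (M0 : forall n x, 0 <= M n x).
Context (sM : supermartingale P F M).

(** The event that first passage to level [c] has not occurred before time [n]; time [n] itself is
    excluded, so [below c 0] is the whole space. *)
Definition below (c : R) (n : nat) : set T := [set x | forall s, (s < n)%N -> M s x < c].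

Lemma belowS c n : below c n.+1 = below c n `&` [set x | M n x < c].
Proof.
apply/seteqP; split => [x h|x [h hn] s].
  by split => [s sn|]; apply: h => //; exact: ltnW.
by rewrite ltnS leq_eqVlt => /predU1P[->//|]; exact: h.
Qed.

Lemma filtration_lt_ge (c : R) n :
  F n [set x | M n x < c] /\ F n [set x | c <= M n x].
Proof.
have [mM _] := sM; split.
  rewrite (_ : [set _ | _] = M n @^-1` `]-oo, c[%classic); last first.
    by apply/seteqP; split => x /=; rewrite in_itv.
  by apply: mM; exact: measurable_itv.
rewrite (_ : [set _ | _] = M n @^-1` `[c, +oo[%classic); last first.
  by apply/seteqP; split => x /=; rewrite in_itv /= andbT.
by apply: mM; exact: measurable_itv.
Qed.

Lemma below_adapted c n : F n (below c n).
Proof.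
have [sF [_ Fsub]] := fF; elim: n => [|n IHn].
  rewrite (_ : below c 0 = setT); last by apply/seteqP; split.
  by rewrite -(measurable_g_measurableTypeE (sF 0)); exact: measurableT.
rewrite belowS; apply/Fsub/(sigma_algebra_setI (sF n)) => //.
by have [] := filtration_lt_ge c n.
Qed.

(** The left side is at most the mean of [M] stopped at first passage to [c], and it does not
    increase with [n]: on the new crossing event [c <= M n], and on [below c n.+1] the
    supermartingale inequality replaces [M n] by [M n.+1]. *)
Lemma ville_finite c n : 0 < c ->
  (c%:E * P (~` below c n) + \int[P]_(x in below c n) (M n x)%:E <=
   \int[P]_x (M 0 x)%:E)%E.
Proof.
move=> c0; have [sF [Fm _]] := fF; have [mM [_ sup]] := sM.
have mMn k : measurable_fun setT (EFin \o M k).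
  by apply/measurable_EFinP; exact: measurable_rmeas (mM k).
elim: n => [|n]; first rewrite (_ : below c 0 = setT).
- by rewrite setCT measure0 mule0 add0e.
- by apply/seteqP; split.
apply: le_trans; set B := below c n.
pose Hi := B `&` [set x | c <= M n x].
have mB : measurable B := Fm _ _ (below_adapted c n).
have FHi : F n Hi.
  by apply: (sigma_algebra_setI (sF n)); [exact: below_adapted|exact: (filtration_lt_ge c n).2].
have FB1 : F n (below c n.+1).
  by rewrite belowS; apply: (sigma_algebra_setI (sF n)); [exact: below_adapted|exact: (filtration_lt_ge c n).1].
have mHi := Fm _ _ FHi; have mB1 := Fm _ _ FB1.
have BE : B = Hi `|` below c n.+1.
  rewrite belowS -setIUr; apply/seteqP; split => [x Bx|x []//].
  by split => //=; case: (leP c (M n x)); [left|right].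
have disj : [disjoint Hi & below c n.+1].
  apply/disj_setPS => x [[_ /= h1]]; rewrite belowS => -[_ /=].
  by rewrite ltNge h1.
have CE : ~` below c n.+1 = ~` B `|` Hi.
  rewrite belowS setCI; apply/seteqP; split => [x [nB|/= nM]|x [nB|[Bx /= cM]]].
  - by left.
  - have [Bx|nB] := pselect (B x); last by left.
    by right; split => //=; rewrite leNgt; apply/negP.
  - by left.
  - by right => /=; rewrite ltNge cM.
have -> : P (~` below c n.+1) = (P (~` B) + P Hi)%E.
  rewrite CE measureU //; first exact: measurableC.
  by apply/seteqP; split => // x [nB []].
rewrite ge0_muleDr // -addeA leeD2l //.
rewrite {1}BE ge0_integral_setU //; last 2 first.
- exact: (measurable_funTS (mMn _)).
- by move=> x _; rewrite lee_fin.
apply: leeD; last exact: (sup n).2.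
rewrite -integral_cst //; apply: ge0_le_integral => //.
- by move=> x _; rewrite lee_fin ltW.
- exact: (measurable_funTS (mMn _)).
- by move=> x [_ /=]; rewrite lee_fin.
Qed.

(** The finite bound gives crossing before [n] probability at most [1 / c]; continuity from above
    along the decreasing events reaches all times at once. *)
Lemma ville c : 0 < c -> (\int[P]_x (M 0 x)%:E <= 1)%E ->
  measurable (\bigcap_n below c n) /\
  ((1 - c^-1)%:E <= P (\bigcap_n below c n))%E.
Proof.
move=> c0 M01; have [_ [Fm _]] := fF.
have mB n : measurable (below c n) := Fm _ _ (below_adapted c n).
have mC : measurable (\bigcap_n below c n) by exact: bigcap_measurable.
split => //.
have le n : ((1 - c^-1)%:E <= P (below c n))%E.
  have h : (c%:E * P (~` below c n) <= 1)%E.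
    apply: le_trans (le_trans (ville_finite n c0) M01).
    by rewrite leeDl // integral_ge0 // => x _; rewrite lee_fin.
  have pf : P (below c n) \is a fin_num by exact: fin_num_measure.
  move: h; rewrite probability_setC // -(fineK pf) -EFinB -EFinM !lee_fin.
  move: (fine _) => p; rewrite -ler_pdivlMl // mulr1 => h.
  by rewrite lerBlDr addrC -lerBlDr.
have cv : P (below c n) @[n --> \oo] --> P (\bigcap_n below c n).
  apply: nonincreasing_cvg_mu => //.
  - by rewrite (le_lt_trans (probability_le1 _ _)) // ltry.
  - move=> n m nm; apply/subsetPset => x h s sn; apply: h.
    exact: leq_trans nm.
rewrite -(cvg_lim _ cv) //; apply: lime_ge; first by apply/cvg_ex; eexists; exact: cv.
by apply: nearW.
Qed.

End Ville.

(** * The self-normalized supermartingale *)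

Section SelfNormalized.
Context {d : measure_display} {T : measurableType d} {R : realType}.
Context {H : normedModType R} (ip : H -> H -> R) (ipP : is_inner_product ip).
Context (D : set H) (cD : countable D) (dD : closure D = setT).
Context (P : probability T R) (F : nat -> set_system T) (fF : filtration F).
Context (g : nat -> T -> H) (y : nat -> T -> R) (rho : R) (rho0 : 0 < rho).
Context (mg : forall s, hmeas (F s) (g s)) (my : forall s, rmeas (F s.+1) (y s)).
Context (suby : forall s c A, F s A ->
  (\int[P]_(x in A) (expR (c * y s x))%:E <= \int[P]_(x in A) (expR (c ^+ 2 / 2))%:E)%E).

Let inv t x := res ip rho (g ^~ x) t.
Definition psum t x : H := \sum_(s < t) y s x *: g s x.
(** [leverage] and [drift] are the [a] and [b] of the one-step factor: variance and mean of the
    Gaussian law of [l]. *)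
Definition leverage t x : R := ip (g t x) (inv t x (g t x)).
Definition drift t x : R := ip (g t x) (inv t x (psum t x)).
(** M_t with the determinant written as a product of rank-one factors and the squared norm as a
    quadratic form in the inverse; [y] is the noise already divided by sigma. *)
Definition mix t x : R :=
  (Num.sqrt (\prod_(s < t) (1 + leverage s x)))^-1 *
  expR (2^-1 * ip (psum t x) (inv t x (psum t x))).

Lemma filtration_mono s t : (s <= t)%N -> F s `<=` F t.
Proof.
case: fF => _ [_ Fs] /subnK <-; elim: (t - s)%N => // n IHn.
exact: subset_trans (Fs _).
Qed.

Lemma leverage_ge0 t x : 0 <= leverage t x.
Proof. exact: res_ge0. Qed.

Lemma rmeas_leverage t : rmeas (F t) (leverage t).
Proof.
have [sF _] := fF.
(* [m = t + 1] admits index [t] itself: by predictability [g t] is already [F t]-measurable. *)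
apply: (rmeas_ip_res ipP cD dD (sF t) rho0 (m := t.+1)) => // s st.
by move=> U oU; apply: (filtration_mono (s := s)); [rewrite -ltnS|exact: mg].
Qed.

(** Expanding [psum] by linearity leaves inner products among the [g s]; the coefficient [y s] is
    [F t]-measurable for [s < t] because [s + 1 <= t]. *)
Lemma rmeas_drift t : rmeas (F t) (drift t).
Proof.
have [sF _] := fF.
rewrite (_ : drift t = fun x => \sum_(s < t) y s x * ip (g t x) (inv t x (g s x))).
  apply: (rmeas_sum (sF t) (X := fun s x => y s x * ip (g t x) (inv t x (g s x)))) => s st.
  apply: rmeasM => //; first exact: rmeas_sub (filtration_mono st) (my s).
  apply: (rmeas_ip_res ipP cD dD (sF t) rho0 (m := t.+1)) => //; last exact: ltnW.
  by move=> r rt U oU; apply: (filtration_mono (s := r)); [rewrite -ltnS|exact: mg].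
apply/funext => x; rewrite /drift /psum -(res_sym ipP) // (ip_sumr ipP).
by apply: eq_bigr => s _; rewrite (ipZr ipP) (res_sym ipP).
Qed.

Lemma mix0 x : mix 0 x = 1.
Proof. by rewrite /mix /psum !big_ord0 (ip0l ipP) mulr0 expR0 sqrtr1 invr1 mulr1. Qed.

Lemma mix_ge0 t x : 0 <= mix t x.
Proof. by rewrite mulr_ge0 ?expR_ge0 // invr_ge0 sqrtr_ge0. Qed.

Lemma mixS t x : mix t.+1 x = mix t x *
  ((Num.sqrt (1 + leverage t x))^-1 *
   expR (2^-1 * ((2 * y t x * drift t x + y t x ^+ 2 * leverage t x - drift t x ^+ 2)
                 / (1 + leverage t x)))).
Proof.
have quad : ip (psum t.+1 x) (inv t.+1 x (psum t.+1 x)) =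
    ip (psum t x) (inv t x (psum t x)) + (2 * y t x * drift t x +
      y t x ^+ 2 * leverage t x - drift t x ^+ 2) / (1 + leverage t x).
  rewrite [psum t.+1 x]big_ord_recr.
  exact: (res_quad_step ipP (g ^~ x) t (psum t x) (y t x) rho0).
rewrite /mix quad big_ord_recr mulrDr expRD sqrtrM; last first.
  by apply: prodr_ge0 => s _; rewrite addr_ge0 // leverage_ge0.
by rewrite invfM mulrACA.
Qed.

Lemma rmeas_mix t : rmeas (F t) (mix t).
Proof.
have [sF [_ Fs]] := fF; elim: t => [|t IHt].
  by rewrite (_ : mix 0 = fun=> 1); [exact: rmeas_cst|apply/funext => x; rewrite mix0].
have ma := rmeas_sub (Fs t) (@rmeas_leverage t).
have mb := rmeas_sub (Fs t) (@rmeas_drift t).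
have ma1 : rmeas (F t.+1) (fun x => 1 + leverage t x).
  by apply: rmeasD => //; exact: rmeas_cst.
have a0 x : 0 < 1 + leverage t x by rewrite ltr_pwDl // leverage_ge0.
rewrite (_ : mix t.+1 = fun x => mix t x *
  ((Num.sqrt (1 + leverage t x))^-1 *
   expR (2^-1 * ((2 * y t x * drift t x + y t x * y t x * leverage t x - drift t x * drift t x)
                 * (1 + leverage t x)^-1)))); last by apply/funext => x; rewrite mixS !expr2.
apply: rmeasM => //; first exact: rmeas_sub (Fs t) IHt.
apply: rmeasM => //.
  by apply: rmeas_inv => //; [move=> x; rewrite sqrtr_gt0|exact: rmeas_sqrt].
apply: rmeas_expR => //; apply: rmeasM => //; first exact: rmeas_cst.
apply: rmeasM => //; last exact: rmeas_inv.
apply: rmeasB => //; last exact: rmeasM.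
apply: rmeasD => //; last by apply: rmeasM => //; exact: rmeasM.
by apply: rmeasM => //; apply: rmeasM => //; exact: rmeas_cst.
Qed.

Lemma measurable_mix t : measurable_fun setT (mix t).
Proof. by have [_ [Fm _]] := fF; exact: measurable_rmeas (Fm t) (@rmeas_mix t). Qed.

(** The indicator of [A] joins [mix t] in the weight, which turns the integral over [A] into one
    over the whole space, as in [mixture_le]. *)
Lemma mix_step t A : F t A ->
  (\int[P]_(x in A) (mix t.+1 x)%:E <= \int[P]_(x in A) (mix t x)%:E)%E.
Proof.
move=> FA; have [sF [Fm _]] := fF.
have ind k : (\int[P]_(x in A) (mix k x)%:E = \int[P]_x (\1_A x * mix k x)%:E)%E.
  rewrite integral_mkcond epatch_indic; apply: eq_integral => x _ /=.
  by rewrite muleC EFinM.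
rewrite !ind.
under eq_integral do rewrite mixS mulrA.
apply: (mixture_le (sF t) (Fm t) _ (@suby t)).
- exact: measurable_rmeas (Fm t.+1) (my t).
- by apply: rmeas_indicM => //; exact: rmeas_mix.
- exact: rmeas_leverage.
- exact: rmeas_drift.
- by move=> x; rewrite mulr_ge0 // mix_ge0.
- by move=> x; exact: leverage_ge0.
Qed.

(** Iterating [mix_step] over the whole space from [mix 0 = 1]; this supplies integrability and the
    initial bound for Ville's inequality. *)
Lemma mix_int_le1 t : (\int[P]_x (mix t x)%:E <= 1)%E.
Proof.
have [sF _] := fF; elim: t => [|t IHt].
  under eq_integral do rewrite mix0.
  by rewrite integral_cst // mul1e probability_le1.
apply: le_trans IHt; apply: mix_step.
by rewrite -(measurable_g_measurableTypeE (sF t)); exact: measurableT.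
Qed.

Lemma mix_supermartingale : supermartingale P F mix.
Proof.
split; first by move=> t; exact: rmeas_mix.
split=> t; last by split; [exact: rmeas_mix|exact: mix_step].
apply/integrableP; split; first by apply/measurable_EFinP; exact: measurable_mix.
under eq_integral do rewrite gee0_abs ?lee_fin ?mix_ge0 //.
by apply: le_lt_trans (mix_int_le1 t) _; exact: ltry.
Qed.

End SelfNormalized.

(** * Return to the original indexing, and the uniform bound *)

Theorem theorem1 (R : realType) (H : completeNormedModType R) (ip : H -> H -> R)
  (d : measure_display) (T : measurableType d) (P : probability T R)
  (F : nat -> set_system T) (f : nat -> T -> H) (eps : nat -> T -> R) (sigma : R) :
  separable_hilbert ip ->
  filtration F ->
  (forall t, (1 <= t)%N -> hmeas (F t.-1) (f t)) ->
  (forall t, (1 <= t)%N -> rmeas (F t) (eps t)) ->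
  0 < sigma ->
  (forall t, (1 <= t)%N -> cond_subgaussian P (F t.-1) sigma (eps t)) ->
  let Ssum := fun (t : nat) (x : T) => \sum_(1 <= s < t.+1) eps s x *: f s x in
  let V := fun (t : nat) (x : T) (h : H) =>
             \sum_(1 <= s < t.+1) rank_one ip (f s x) (f s x) h in
  (forall rho : R, 0 < rho ->
     let M := fun (t : nat) (x : T) =>
       (Num.sqrt (fdet ip (fun h => rho^-1 *: V t x h)))^-1 *
       expR (2^-1 * `| shift_inv_sqrt ip rho (V t x) (sigma^-1 *: Ssum t x) | ^+ 2) in
     (forall t x, 0 <= M t x) /\ supermartingale P F M) /\
  (forall rho delta : R, 0 < rho -> 0 < delta < 1 ->
     exists A : set T, measurable A /\ (P A >= (1 - delta)%:E)%E /\
       forall x, A x -> forall t, (1 <= t)%N ->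
         `| shift_inv_sqrt ip rho (V t x) (Ssum t x) | <=
         sigma * Num.sqrt (2 * ln (delta^-1 *
                                   Num.sqrt (fdet ip (fun h => rho^-1 *: V t x h))))).
Proof.
move=> [ipP [D [cD dD]]] fF mf me s0 sub Ssum V.
(* Indices move from 1 to 0, so that [g s] is [F s]-measurable; dividing by [sigma] makes the noise
   conditionally 1-sub-Gaussian, by taking [lambda = c / sigma]. *)
pose g s := f s.+1; pose y s x := eps s.+1 x * sigma^-1.
have [sF [Fm _]] := fF.
have mg s : hmeas (F s) (g s) by exact: (mf s.+1).
have my s : rmeas (F s.+1) (y s).
  by apply: rmeasM => //; [exact: me|exact: rmeas_cst].
have suby s c A : F s A -> (\int[P]_(x in A) (expR (c * y s x))%:E <=
    \int[P]_(x in A) (expR (c ^+ 2 / 2))%:E)%E.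
  move=> FA; have [_ /(_ A FA)] := sub s.+1 isT (c * sigma^-1).
  rewrite exprMn exprVn divfK ?sqrf_eq0 ?gt_eqF //.
  by under eq_integral do rewrite -mulrA (mulrC sigma^-1).
have VE t x : V t x = covop ip t (g ^~ x).
  by apply/funext => h; rewrite /V big_add1 big_mkord.
have SE t x : psum g y t x = sigma^-1 *: Ssum t x.
  rewrite /Ssum big_add1 big_mkord scaler_sumr; apply: eq_bigr => s _.
  by rewrite scalerA /y mulrC.
have normE rho t x h : 0 < rho -> `|shift_inv_sqrt ip rho (V t x) h| ^+ 2 =
    ip h (res ip rho (g ^~ x) t h).
  by move=> rho0; rewrite VE; apply: (norm_shift_inv_sqrt ipP rho0); exact: resP.
have detE rho t x : 0 < rho -> fdet ip (fun h => rho^-1 *: V t x h) =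
    \prod_(s < t) (1 + leverage ip g rho s x).
  by move=> rho0; rewrite VE; exact: (fdet_covop ipP).
have mixE rho t x : 0 < rho ->
    (Num.sqrt (fdet ip (fun h => rho^-1 *: V t x h)))^-1 *
    expR (2^-1 * `| shift_inv_sqrt ip rho (V t x) (sigma^-1 *: Ssum t x) | ^+ 2) =
    mix ip g y rho t x.
  by move=> rho0; rewrite normE // detE // /mix SE.
split=> [rho rho0 M|rho delta rho0 /andP[d0 d1]].
  have -> : M = mix ip g y rho by apply/funext => t; apply/funext => x; exact: mixE.
  split; first by move=> t x; exact: mix_ge0.
  exact: (mix_supermartingale ipP cD dD fF rho0 mg my suby).
have sM := mix_supermartingale ipP cD dD fF rho0 mg my suby.
have di0 : 0 < delta^-1 by rewrite invr_gt0.
have [] := ville fF (@mix_ge0 _ _ _ _ ip g y rho) sM di0.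
  exact: (mix_int_le1 ipP cD dD fF rho0 mg my suby 0).
(* The event is that M never reaches [1 / delta]; Ville's inequality at this level gives it
   probability at least [1 - delta]. *)
rewrite invrK => mA PA; exists (\bigcap_n below (mix ip g y rho) delta^-1 n).
split; [exact: mA|split; [exact: PA|]] => x Ax t _.
(* [below] looks at strictly earlier times, so time [t] is read off at [t + 1]. *)
have := Ax t.+1 I t (ltnSn t); rewrite -mixE // normE // (ipZl ipP) (resZ ipP) // (ipZr ipP).
set q := ip _ _; set dt := fdet _ _.
have nq : `|shift_inv_sqrt ip rho (V t x) (Ssum t x)| ^+ 2 = q by rewrite normE.
have dt0 : 0 < dt.
  rewrite /dt detE //; apply: prodr_gt0 => s _.
  by rewrite ltr_pwDl // (leverage_ge0 ipP).
have sdt0 : 0 < Num.sqrt dt by rewrite sqrtr_gt0.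
(* Positivity of the determinant lets its root move to the right of [M_t < 1 / delta]; taking
   logarithms bounds the exponent. *)
rewrite mulrC ltr_pdivrMr // => lt_mix.
have lnlt : 2^-1 * (sigma^-1 * (sigma^-1 * q)) < ln (delta^-1 * Num.sqrt dt).
  by rewrite -ltr_expR lnK // posrE mulr_gt0.
(* Both sides are written as square roots, so that the claim becomes a bound on [q], the logarithmic
   one multiplied by [2 sigma^2]. *)
rewrite -[leLHS]ger0_norm // -sqrtr_sqr nq.
have -> : sigma = Num.sqrt (sigma ^+ 2) by rewrite sqrtr_sqr gtr0_norm.
rewrite -sqrtrM ?sqr_ge0 // ler_wsqrtr //.
have -> : q = sigma ^+ 2 * (2 * (2^-1 * (sigma^-1 * (sigma^-1 * q)))).
  by field; rewrite gt_eqF.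
by rewrite ler_wpM2l ?sqr_ge0 // ler_wpM2l // ltW.
Qed.
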